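(* Let $m\in\mathbb{N}$. The *-algebra $\widetilde{\mathcal{A}}^{*(m)}$ can be equipped with the coproduct $$\Delta^{(m)}(\mathbf{1})=\mathbf{1}\otimes\mathbf{1},\qquad \Delta^{(m)}(t_{(i)})=t_{(i)}\otimes t_{(i)},$$ $$\Delta^{(m)}(a_{(k)}-a_{(k+1)})=(a_{(k)}-a_{(k+1)})\otimes t_{[k,m]}+t_{[k,m]}\otimes(a_{(k)}-a_{(k+1)}),$$ where $i,k\in\{1,\ldots,m\}$, $a\in\mathcal{G}$ and it is understood that $a_{(m+1)}=0$, and the counit $$\epsilon^{(m)}(t_{(k)})=\epsilon^{(m)}(\mathbf{1})=1,\qquad \epsilon^{(m)}(a_{(k)})=0,$$ so that $(\widetilde{\mathcal{A}}^{*(m)},\Delta^{(m)},\epsilon^{(m)})$ becomes a *-bialgebra. Moreover, $$\widehat{j}^{(m)}\circ\delta=\Delta^{(m)}\circ\widehat{i}_1,$$ where $\widehat{i}_1:\mathcal{A}\to\widetilde{\mathcal{A}}^{*(m)}$ is the canonical *-homomorphic embedding given by $\widehat{i}_1(a)=a_{(1)}$.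
   Context: $\mathcal{A}$ is the unital free *-algebra over $\mathbb{C}$ generated by a set $\mathcal{G}^+$: the free unital algebra on the letters $\mathcal{G}=\mathcal{G}^+\cup\mathcal{G}^-$, $\mathcal{G}^-=\{a^*:a\in\mathcal{G}^+\}$, with involution the antilinear extension of $(a_1\ldots a_k)^*=a_k^*\ldots a_1^*$. $\widetilde{\mathcal{A}}=\mathcal{A}*\mathbb{C}[t]$ is the free product with identified units, where $t=t^*$. $\widetilde{\mathcal{A}}^{*(m)}=\widetilde{\mathcal{A}}*\cdots*\widetilde{\mathcal{A}}$ ($m$ times) is the $m$-fold free product; $a_{(i)}$ and $t_{(i)}$ denote the copies of $a\in\mathcal{G}$ and of $t$ in the $i$-th factor, $1\le i\le m$. Put $t_{[k,m]}=t_{(k)}t_{(k+1)}\ldots t_{(m)}$. Tensor products are algebraic with componentwise involution. A *-bialgebra is a unital *-algebra that is also a coalgebra whose coproduct and counit are unital *-homomorphisms; accordingly $\Delta^{(m)}:\widetilde{\mathcal{A}}^{*(m)}\to\widetilde{\mathcal{A}}^{*(m)}\otimes\widetilde{\mathcal{A}}^{*(m)}$ and $\epsilon^{(m)}:\widetilde{\mathcal{A}}^{*(m)}\to\mathbb{C}$ are taken to be the *-homomorphisms given on generators by the formulas in the claim. $\widehat{j}^{(m)}:\mathcal{A}*\mathcal{A}\to\widetilde{\mathcal{A}}^{*(m)}\otimes\widetilde{\mathcal{A}}^{*(m)}$ is the *-homomorphism defined as the linear and multiplicative extension of $\widehat{j}^{(m)}(\mathbf{1})=\mathbf{1}\otimes\mathbf{1}$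 and of the following: for every $a\in\mathcal{G}$, the copy $a^{(1)}$ of $a$ in the first factor and the copy $a^{(2)}$ of $a$ in the second factor of $\mathcal{A}*\mathcal{A}$ are sent, respectively, to $$\widehat{j}_1^{(m)}(a)=\sum_{k=1}^m(a_{(k)}-a_{(k+1)})\otimes t_{[k,m]},\qquad \widehat{j}_2^{(m)}(a)=\sum_{k=1}^m t_{[k,m]}\otimes(a_{(k)}-a_{(k+1)}),$$ with $a_{(m+1)}=0$. $\delta:\mathcal{A}\to\mathcal{A}*\mathcal{A}$ is the *-homomorphism defined by $\delta(\mathbf{1})=\mathbf{1}$, $\delta(a)=a^{(1)}+a^{(2)}$ for $a\in\mathcal{G}$.
   Formalization: As t_[k,m]* ≠ t_[k,m] for k<m, the formulas on all of G contradict Δ, ĵ being *-maps if m≥2, G⁺≠∅. Proved: the bialgebra and ĵ identity with these formulas (Δ a *-map claimed only for m=1), and a *-bialgebra with ĵ identity where t_[k,m] is replaced by its adjoint for a in G⁻. *)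

(* Defs.v *)
From HB Require Import structures.
From mathcomp Require Import all_boot all_order all_algebra finmap.
From mathcomp Require Import reals complex.
From mathcomp.multinomials Require Import monalg.

Set Implicit Arguments.
Unset Strict Implicit.
Unset Printing Implicit Defensive.

Import GRing.Theory Num.Theory.
Local Open Scope fset_scope.
Local Open Scope ring_scope.

Lemma malg_scaleAr (K : monomType) (C : comNzRingType) (c : C)
    (x y : {malg C[K]}) : c *: (x * y) = x * (c *: y).
Proof.
apply/malgP => k; rewrite mcoeffZ.
have h (g : {malg C[K]}) : msupp g `<=` msupp g `|` msupp (c *: g).
  exact: fsubsetUl.
have h' (g : {malg C[K]}) : msupp (c *: g) `<=` msupp g `|` msupp (c *: g).
  exact: fsubsetUr.
rewrite (mcoeffMlw _ (fsubset_refl _) (h y)) (mcoeffMlw _ (fsubset_refl _) (h' y)).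
rewrite mulr_sumr; apply: eq_bigr => u _; rewrite mulr_sumr; apply: eq_bigr => v _.
by rewrite mcoeffZ mulrnAr mulrCA.
Qed.

(* Linear extension of a map defined on the basis K of C[K]. *)
HB.lock Definition mlin (K : choiceType) (C : comNzRingType) (V : lmodType C)
    (f : K -> V) (x : {malg C[K]}) : V :=
  \sum_(u <- msupp x) x@_u *: f u.
Arguments mlin {K C V} f x.

Section LinearExtension.
Variables (K : choiceType) (C : comNzRingType) (V : lmodType C) (f : K -> V).
Local Notation mlin := (mlin f).

Lemma mlinE (x : {malg C[K]}) : mlin x = \sum_(u <- msupp x) x@_u *: f u.
Proof. by rewrite mlin.unlock. Qed.

Lemma mlinEw (d : {fset K}) (x : {malg C[K]}) : msupp x `<=` d ->
  mlin x = \sum_(u <- d) x@_u *: f u.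
Proof.
move=> le; rewrite mlin.unlock [LHS](big_fset_incl _ le) => //= u ud /mcoeff_outdom ->.
by rewrite scale0r.
Qed.

Fact mlin_is_linear : linear mlin.
Proof.
move=> c x y; set d := msupp x `|` msupp y `|` msupp (c *: x + y).
have dx : msupp x `<=` d by rewrite /d -fsetUA fsubsetUl.
have dy : msupp y `<=` d by rewrite /d -fsetUA fsetUCA fsubsetUl.
have dxy : msupp (c *: x + y) `<=` d by rewrite /d fsubsetUr.
rewrite (mlinEw dx) (mlinEw dy) (mlinEw dxy).
rewrite scaler_sumr -big_split; apply: eq_bigr => u _ /=.
by rewrite mcoeffD mcoeffZ scalerDl scalerA.
Qed.

HB.instance Definition _ :=
  GRing.isLinear.Build C {malg C[K]} V *:%R mlin mlin_is_linear.

Lemma mlinU (u : K) : mlin << u >> = f u.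
Proof. by rewrite (mlinEw msuppU_le) big_seq_fset1 mcoeffUU scale1r. Qed.

End LinearExtension.

Lemma malg_lin_ext (K : choiceType) (C : comNzRingType) (V : lmodType C)
    (f g : {linear {malg C[K]} -> V}) :
  (forall u : K, f << u >> = g << u >>) -> f =1 g.
Proof.
move=> fg x; rewrite (monalgE x) !linear_sum; apply: eq_bigr => u _.
have -> : << x@_u *g u >> = x@_u *: << u >> :> {malg C[K]}.
  by apply/malgP => v; rewrite mcoeffZ !mcoeffU mulr_natr.
by rewrite !linearZ /= fg.
Qed.

(* The tensor product: C[K] and C[L] are free C-modules on K and L, and
   C[K] (x) C[L] is realized as the free module C[K x L], with basis the
   << u >> (x) << v >>; [tliftE] and [tens_ext] give its universal property. *)
HB.lock Definition tens (K L : choiceType) (C : comNzRingType) (x : {malg C[K]})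
    (y : {malg C[L]}) : {malg C[(K * L)%type]} :=
  mlin (fun u => mlin (fun v => << (u, v) >>) y) x.


Arguments tens {K L C} x y.

Section TensorModule.
Variables (K L : choiceType) (C : comNzRingType).
Local Notation A := {malg C[K]}.
Local Notation B := {malg C[L]}.

Lemma tens_linear_l (y : B) : linear (fun x : A => tens x y).
Proof. by move=> c x x'; rewrite tens.unlock linearP. Qed.

Lemma tens0l (y : B) : tens (0 : A) y = 0.
Proof. by rewrite tens.unlock linear0. Qed.

Lemma tens_linear_r (x : A) : linear (@tens K L C x).
Proof.
move=> c y y'; rewrite tens.unlock !(mlinE _ x) scaler_sumr -big_split.
by apply: eq_bigr => u _; rewrite linearP /= scalerDr !scalerA mulrC.
Qed.

HB.instance Definition _ x := GRing.isLinear.Build C B _ *:%R (@tens K L C x)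
  (tens_linear_r x).

Lemma tensUU (u : K) (v : L) : tens (<< u >> : A) (<< v >> : B) = << (u, v) >>.
Proof. by rewrite tens.unlock !mlinU. Qed.

Lemma mcoeff_tens (x : A) (y : B) (u : K) (v : L) : (tens x y)@_(u, v) = x@_u * y@_v.
Proof.
pose f (x0 : A) : C^o := (tens x0 y)@_(u, v).
pose g (x0 : A) : C^o := x0@_u * y@_v.
have fL : linear f by move=> c a b; rewrite /f tens_linear_l mcoeffD mcoeffZ.
have gL : linear g by move=> c a b; rewrite /g mcoeffD mcoeffZ mulrDl -mulrA.
pose F := HB.pack f (GRing.isLinear.Build C A C^o *:%R f fL) : {linear A -> C^o}.
pose G := HB.pack g (GRing.isLinear.Build C A C^o *:%R g gL) : {linear A -> C^o}.
apply: (malg_lin_ext (f := F) (g := G)) => u0; rewrite /= /f /g.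
pose f' (y0 : B) : C^o := (tens (<< u0 >> : A) y0)@_(u, v).
pose g' (y0 : B) : C^o := (<< u0 >> : A)@_u * y0@_v.
have fL' : linear f' by move=> c a b; rewrite /f' tens_linear_r mcoeffD mcoeffZ.
have gL' : linear g'.
  by move=> c a b; rewrite /g' mcoeffD mcoeffZ mulrDr mulrCA.
pose F' := HB.pack f' (GRing.isLinear.Build C B C^o *:%R f' fL') : {linear B -> C^o}.
pose G' := HB.pack g' (GRing.isLinear.Build C B C^o *:%R g' gL') : {linear B -> C^o}.
apply: (malg_lin_ext (f := F') (g := G')) => v0; rewrite /= /f' /g'.
by rewrite tensUU !mcoeffU xpair_eqE -natrM mulnb.
Qed.

Variable V : lmodType C.

(* The linear map x (x) y |-> b x y induced by a bilinear map b. *)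
Definition tlift (b : A -> B -> V) : {malg C[(K * L)%type]} -> V :=
  mlin (fun p => b << p.1 >> << p.2 >>).

HB.instance Definition _ b := GRing.Linear.on (tlift b).

Lemma tliftE (b : A -> B -> V) (bl : forall y, linear (b^~ y))
    (br : forall x, linear (b x)) x y : tlift b (tens x y) = b x y.
Proof.
pose f (x0 : A) := tlift b (tens x0 y).
pose g x0 := b x0 y.
have fL : linear f by move=> c a a'; rewrite /f tens_linear_l linearP.
pose F := HB.pack f (GRing.isLinear.Build C A V *:%R f fL) : {linear A -> V}.
pose G := HB.pack g (GRing.isLinear.Build C A V *:%R g (bl y)) : {linear A -> V}.
apply: (malg_lin_ext (f := F) (g := G)) => u /=; rewrite /f /g.
pose f' (y0 : B) := tlift b (tens (<< u >> : A) y0).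
have fL' : linear f' by move=> c a a'; rewrite /f' !linearP.
pose F' := HB.pack f' (GRing.isLinear.Build C B V *:%R f' fL') : {linear B -> V}.
pose G' := HB.pack (b << u >>) (GRing.isLinear.Build C B V *:%R _ (br << u >>))
  : {linear B -> V}.
apply: (malg_lin_ext (f := F') (g := G')) => v /=; rewrite /f'.
by rewrite tensUU /tlift mlinU.
Qed.

Lemma tens_ext (f g : {linear {malg C[(K * L)%type]} -> V}) :
  (forall (x : A) (y : B), f (tens x y) = g (tens x y)) -> f =1 g.
Proof. by move=> fg; apply: malg_lin_ext => -[u v]; rewrite -tensUU fg. Qed.

End TensorModule.

Notation "x \ox y" := (tens x y)
  (at level 40, left associativity) : ring_scope.

Section ProdMonom.
Variables K L : monomType.

Definition pone : K * L := (@mone K, @mone L).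
Definition pmul (p q : K * L) : K * L := (mmul p.1 q.1, mmul p.2 q.2).

Fact pmulA : associative pmul.
Proof. by move=> p q r; rewrite /pmul !mulmA. Qed.

Fact pmul1m : left_id pone pmul.
Proof. by move=> [u v]; rewrite /pmul !mul1m. Qed.

Fact pmulm1 : right_id pone pmul.
Proof. by move=> [u v]; rewrite /pmul !mulm1. Qed.

Fact pmul_eq1 p q : pmul p q = pone -> p = pone /\ q = pone.
Proof.
by case: p q => [u v] [u' v'] [/unitm[-> ->] /unitm[-> ->]].
Qed.

HB.instance Definition _ := Choice_isMonomialDef.Build (K * L)%type
  pmulA pmul1m pmulm1 pmul_eq1.

End ProdMonom.

Lemma malgUM (K : monomType) (C : comNzRingType) (u v : K) :
  << u >> * << v >> = << mmul u v >> :> {malg C[K]}.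
Proof. by rewrite malgM_def fgmulUU mulr1. Qed.

Section TensorAlgebra.
Variables (K L : monomType) (C : comNzRingType).

Lemma tensM (x x' : {malg C[K]}) (y y' : {malg C[L]}) :
  (x \ox y) * (x' \ox y') = (x * x') \ox (y * y').
Proof.
pose f1 a := (a \ox y) * (x' \ox y').
pose g1 a := (a * x') \ox (y * y').
have f1L : linear f1.
  by move=> c a b; rewrite /f1 tens_linear_l mulrDl scalerAl.
have g1L : linear g1.
  by move=> c a b; rewrite /g1 mulrDl -scalerAl tens_linear_l.
pose F1 := HB.pack f1 (GRing.isLinear.Build C _ _ *:%R f1 f1L)
  : {linear {malg C[K]} -> _}.
pose G1 := HB.pack g1 (GRing.isLinear.Build C _ _ *:%R g1 g1L)
  : {linear {malg C[K]} -> _}.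
apply: (malg_lin_ext (f := F1) (g := G1)) => u /=; rewrite /f1 /g1 {F1 G1 f1L g1L f1 g1}.
pose f1 a := (<< u >> \ox y) * (a \ox y').
pose g1 a := (<< u >> * a) \ox (y * y').
have f1L : linear f1.
  by move=> c a b; rewrite /f1 tens_linear_l mulrDr malg_scaleAr.
have g1L : linear g1.
  by move=> c a b; rewrite /g1 mulrDr -malg_scaleAr tens_linear_l.
pose F1 := HB.pack f1 (GRing.isLinear.Build C _ _ *:%R f1 f1L)
  : {linear {malg C[K]} -> _}.
pose G1 := HB.pack g1 (GRing.isLinear.Build C _ _ *:%R g1 g1L)
  : {linear {malg C[K]} -> _}.
apply: (malg_lin_ext (f := F1) (g := G1)) => u' /=; rewrite /f1 /g1 {F1 G1 f1L g1L f1 g1}.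
pose f1 a := (<< u >> \ox a) * (<< u' >> \ox y').
pose g1 a := (<< u >> * << u' >>) \ox (a * y').
have f1L : linear f1.
  by move=> c a b; rewrite /f1 tens_linear_r mulrDl scalerAl.
have g1L : linear g1.
  by move=> c a b; rewrite /g1 mulrDl -scalerAl tens_linear_r.
pose F1 := HB.pack f1 (GRing.isLinear.Build C _ _ *:%R f1 f1L)
  : {linear {malg C[L]} -> _}.
pose G1 := HB.pack g1 (GRing.isLinear.Build C _ _ *:%R g1 g1L)
  : {linear {malg C[L]} -> _}.
apply: (malg_lin_ext (f := F1) (g := G1)) => v /=; rewrite /f1 /g1 {F1 G1 f1L g1L f1 g1}.
pose f1 (a : {malg C[L]}) := (<< u >> \ox << v >>) * (<< u' >> \ox a).
pose g1 (a : {malg C[L]}) := (<< u >> * << u' >>) \ox (<< v >> * a).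
have f1L : linear f1.
  by move=> c a b; rewrite /f1 tens_linear_r mulrDr malg_scaleAr.
have g1L : linear g1.
  by move=> c a b; rewrite /g1 mulrDr -malg_scaleAr tens_linear_r.
pose F1 := HB.pack f1 (GRing.isLinear.Build C _ _ *:%R f1 f1L)
  : {linear {malg C[L]} -> _}.
pose G1 := HB.pack g1 (GRing.isLinear.Build C _ _ *:%R g1 g1L)
  : {linear {malg C[L]} -> _}.
apply: (malg_lin_ext (f := F1) (g := G1)) => v' /=; rewrite /f1 /g1 {F1 G1 f1L g1L f1 g1}.
by rewrite !tensUU !malgUM tensUU.
Qed.

Lemma tens1 : 1 \ox 1 = 1 :> {malg C[(K * L)%type]}.
Proof. exact: tensUU. Qed.

End TensorAlgebra.

Section TensorMaps.
Variables (C : comNzRingType) (K L M K' L' : choiceType).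

Definition tmap (f : {malg C[K]} -> {malg C[K']})
    (g : {malg C[L]} -> {malg C[L']}) :
    {malg C[(K * L)%type]} -> {malg C[(K' * L')%type]} :=
  tlift (fun x y => f x \ox g y).

Definition tassoc :
    {malg C[((K * L) * M)%type]} -> {malg C[(K * (L * M))%type]} :=
  tlift (fun z c => tlift (fun a b => a \ox (b \ox c)) z).

End TensorMaps.

(* Antilinear extension of an involution of the basis. *)
HB.lock Definition malg_star (C : numClosedFieldType) (K : choiceType) (s : K -> K)
    (x : {malg C[K]}) : {malg C[K]} :=
  \sum_(u <- msupp x) << (x@_u)^* *g s u >>.
Arguments malg_star {C K} s x.

Definition pair_star (K L : Type) (s : K -> K) (s' : L -> L) (p : K * L) :=
  (s p.1, s' p.2).

Definition word_star (X : choiceType) (i : X -> X) (w : {fmonom X}) : {fmonom X} :=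
  FMonom (rev (map i w)).

Section StarLemmas.
Variable C : numClosedFieldType.

Section Star.
Variables (K : choiceType) (s : K -> K).
Local Notation star := (malg_star (C := C) s).

Lemma malg_starEw (d : {fset K}) (x : {malg C[K]}) : msupp x `<=` d ->
  star x = \sum_(u <- d) << (x@_u)^* *g s u >>.
Proof.
move=> le; rewrite malg_star.unlock [LHS](big_fset_incl _ le) => //= u ud /mcoeff_outdom ->.
by rewrite rmorph0 monalgU0.
Qed.

Lemma malg_star_antilinear c x y : star (c *: x + y) = c^* *: star x + star y.
Proof.
set d := msupp x `|` msupp y `|` msupp (c *: x + y).
have dx : msupp x `<=` d by rewrite /d -fsetUA fsubsetUl.
have dy : msupp y `<=` d by rewrite /d -fsetUA fsetUCA fsubsetUl.
have dxy : msupp (c *: x + y) `<=` d by rewrite /d fsubsetUr.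
rewrite (malg_starEw dx) (malg_starEw dy) (malg_starEw dxy).
rewrite scaler_sumr -big_split; apply: eq_bigr => u _ /=.
rewrite mcoeffD mcoeffZ rmorphD rmorphM /= monalgUD; congr (_ + _).
by apply/malgP => k; rewrite mcoeffZ !mcoeffU mulrnAr.
Qed.

Lemma malg_starU u : star << u >> = << s u >>.
Proof. by rewrite (malg_starEw msuppU_le) big_seq_fset1 mcoeffUU rmorph1. Qed.

Lemma malg_starD : {morph star : x y / x + y}.
Proof.
by move=> x y; rewrite -[x in LHS]scale1r malg_star_antilinear rmorph1 scale1r.
Qed.

Lemma malg_star0 : star 0 = 0.
Proof. by apply: (addrI (star 0)); rewrite -malg_starD !addr0. Qed.

Lemma malg_starZ c x : star (c *: x) = c^* *: star x.
Proof. by rewrite -[c *: x]addr0 malg_star_antilinear malg_star0 addr0. Qed.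

Lemma malg_star_sum I (r : seq I) (P : pred I) F :
  star (\sum_(i <- r | P i) F i) = \sum_(i <- r | P i) star (F i).
Proof. exact: (big_morph _ malg_starD malg_star0). Qed.

End Star.

Lemma malg_basis_ind (K : choiceType) (P : {malg C[K]} -> Prop) :
  P 0 -> (forall c u x, P x -> P (c *: << u >> + x)) -> forall x, P x.
Proof.
move=> P0 PS x; rewrite (monalgE x); elim: (enum_fset _) => [|u r IH].
  by rewrite big_nil.
rewrite big_cons; have -> : << x@_u *g u >> = x@_u *: << u >> :> {malg C[K]}.
  by apply/malgP => v; rewrite mcoeffZ !mcoeffU mulr_natr.
exact: PS.
Qed.

Lemma malg_starK (K : choiceType) (s : K -> K) :
  involutive s -> involutive (malg_star (C := C) s).
Proof.
move=> sK; elim/malg_basis_ind => [|c u x IH]; first by rewrite !malg_star0.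
by rewrite !malg_star_antilinear !malg_starU sK conjCK IH.
Qed.

Lemma malg_starM (K : monomType) (s : K -> K) :
  (forall u v, s (mmul u v) = mmul (s v) (s u)) ->
  forall x y : {malg C[K]}, malg_star s (x * y) = malg_star s y * malg_star s x.
Proof.
move=> sM x y; elim/malg_basis_ind: x => [|c u x IH].
  by rewrite mul0r malg_star0 mulr0.
rewrite mulrDl -scalerAl !malg_star_antilinear IH mulrDr -malg_scaleAr malg_starU.
congr (_ *: _ + _); elim/malg_basis_ind: y {IH} => [|d v y IH].
  by rewrite mulr0 malg_star0 mul0r.
rewrite mulrDr -malg_scaleAr !malg_star_antilinear IH mulrDl -scalerAl malg_starU.
by rewrite !malgUM malg_starU sM.
Qed.

Lemma malg_star_tens (K L : choiceType) (s : K -> K) (s' : L -> L)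
    (x : {malg C[K]}) (y : {malg C[L]}) :
  malg_star (pair_star s s') (x \ox y) = malg_star s x \ox malg_star s' y.
Proof.
elim/malg_basis_ind: x => [|c u x IH].
  by rewrite malg_star0 !tens0l malg_star0.
rewrite tens_linear_l !malg_star_antilinear IH tens_linear_l malg_starU.
congr (_ *: _ + _); elim/malg_basis_ind: y {IH} => [|d v y IH].
  by rewrite linear0 !malg_star0 linear0.
rewrite tens_linear_r !malg_star_antilinear IH tens_linear_r malg_starU.
by rewrite !tensUU malg_starU.
Qed.

End StarLemmas.

(* The free unital algebra on the letters X is C[{fmonom X}], the monoid
   algebra of the words in X; [falg_univ] and [falg_ext] give its universal
   property. *)
Section FreeAlgebra.
Variables (C : comNzRingType) (X : choiceType).
Local Notation F := {malg C[{fmonom X}]}.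

Definition fgen (a : X) : F := << fmu a >>.

Section Lift.
Variables (B : lalgType C) (f : X -> B).

(* Linear and multiplicative extension of f. *)
Definition falg_lift : F -> B := mlin (fun w : {fmonom X} => \prod_(a <- w) f a).

HB.instance Definition _ := GRing.Linear.on falg_lift.

Lemma falg_lift_gen a : falg_lift (fgen a) = f a.
Proof. by rewrite /falg_lift mlinU fmU big_seq1. Qed.

Lemma falg_lift_monoid :
  (forall c (x y : B), c *: (x * y) = x * (c *: y)) -> monoid_morphism falg_lift.
Proof.
move=> scA; split; first by rewrite /falg_lift mlinU fm1 big_nil.
move=> x y.
pose f1 a := falg_lift (a * y).
pose g1 a := falg_lift a * falg_lift y.
have f1L : linear f1 by move=> c a b; rewrite /f1 mulrDl -scalerAl linearP.
have g1L : linear g1 by move=> c a b; rewrite /g1 linearP mulrDl scalerAl.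
pose F1 := HB.pack f1 (GRing.isLinear.Build C _ _ *:%R f1 f1L) : {linear F -> B}.
pose G1 := HB.pack g1 (GRing.isLinear.Build C _ _ *:%R g1 g1L) : {linear F -> B}.
apply: (malg_lin_ext (f := F1) (g := G1)) => u /=; rewrite /f1 /g1 {F1 G1 f1L g1L f1 g1}.
pose f1 a := falg_lift (<< u >> * a).
pose g1 a := falg_lift << u >> * falg_lift a.
have f1L : linear f1 by move=> c a b; rewrite /f1 mulrDr -malg_scaleAr linearP.
have g1L : linear g1 by move=> c a b; rewrite /g1 linearP mulrDr scA.
pose F1 := HB.pack f1 (GRing.isLinear.Build C _ _ *:%R f1 f1L) : {linear F -> B}.
pose G1 := HB.pack g1 (GRing.isLinear.Build C _ _ *:%R g1 g1L) : {linear F -> B}.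
apply: (malg_lin_ext (f := F1) (g := G1)) => v /=; rewrite /f1 /g1 {F1 G1 f1L g1L f1 g1}.
by rewrite malgUM /falg_lift !mlinU fmM big_cat.
Qed.

Lemma falg_ext (g h : {lrmorphism F -> B}) :
  (forall a, g (fgen a) = h (fgen a)) -> g =1 h.
Proof.
move=> gh; apply: malg_lin_ext => -[w] /=.
elim: w => [|a w IH].
  have -> : << FMonom [::] >> = 1 :> F by congr << _ >>; apply/eqP; rewrite fmP fm1.
  by rewrite !rmorph1.
have -> : << FMonom (a :: w) >> = fgen a * << FMonom w >> :> F.
  by rewrite malgUM; congr << _ >>; apply/eqP; rewrite fmP fmM fmU.
by rewrite !rmorphM /= gh IH.
Qed.

End Lift.

HB.instance Definition _ (K : monomType) (f : X -> {malg C[K]}) :=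
  GRing.isMonoidMorphism.Build F {malg C[K]} (falg_lift f)
    (falg_lift_monoid f (@malg_scaleAr K C)).

Lemma falg_univ (B : algType C) (f : X -> B) :
  exists g : {lrmorphism F -> B}, forall a, g (fgen a) = f a.
Proof.
pose g := falg_lift f.
pose G := HB.pack g (GRing.isLinear.Build C F B *:%R g (@linearP _ _ _ _ (falg_lift f)))
  (GRing.isMonoidMorphism.Build F B g (falg_lift_monoid f (@scalerAr C B)))
  : {lrmorphism F -> B}.
by exists G => a; rewrite /= /g falg_lift_gen.
Qed.

End FreeAlgebra.

Arguments fgen C {X} a.

Section FreeProducts.
Variables (C : comNzRingType) (X : choiceType).
Local Notation F Z := {malg C[{fmonom Z}]}.

Definition fmap_letters (Z : choiceType) (h : X -> Z) : F X -> F Z :=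
  falg_lift (fgen C \o h).

HB.instance Definition _ Z h := GRing.LRMorphism.on (@fmap_letters Z h).

Lemma fmap_letters_gen (Z : choiceType) (h : X -> Z) a :
  fmap_letters h (fgen C a) = fgen C (h a).
Proof. exact: falg_lift_gen. Qed.

End FreeProducts.

(* The free product of free algebras is the free algebra on the disjoint union
   of the letters; the next three lemmas are the corresponding universal
   properties, C[t] being the free algebra on the single letter t. *)
Section FreeProductsUniv.
Variables (C : comNzRingType) (X Y : choiceType) (I : choiceType) (B : algType C).
Local Notation F Z := {malg C[{fmonom Z}]}.

Lemma free_product_univ (f : {lrmorphism F X -> B}) (g : {lrmorphism F Y -> B}) :
  exists2 h : {lrmorphism F (X + Y)%type -> B},
    (forall x, h (fmap_letters inl x) = f x) /\
    (forall y, h (fmap_letters inr y) = g y) &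
    forall h' : {lrmorphism F (X + Y)%type -> B},
      (forall x, h' (fmap_letters inl x) = f x) ->
      (forall y, h' (fmap_letters inr y) = g y) -> h' =1 h.
Proof.
have [h hE] := falg_univ (fun z : X + Y => match z with
  | inl a => f (fgen C a) | inr b => g (fgen C b) end).
exists h; last first.
  move=> h' h'l h'r; apply: falg_ext => -[a|b]; rewrite hE.
    by rewrite -h'l fmap_letters_gen.
  by rewrite -h'r fmap_letters_gen.
split.
  by apply: (falg_ext (g := h \o fmap_letters inl)) => a /=; rewrite fmap_letters_gen hE.
by apply: (falg_ext (g := h \o fmap_letters inr)) => a /=; rewrite fmap_letters_gen hE.
Qed.

Lemma free_product_var_univ (f : {lrmorphism F X -> B}) (b : B) :
  exists2 h : {lrmorphism F (option X) -> B},
    (forall x, h (fmap_letters Some x) = f x) /\ h (fgen C None) = b &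
    forall h' : {lrmorphism F (option X) -> B},
      (forall x, h' (fmap_letters Some x) = f x) ->
      h' (fgen C None) = b -> h' =1 h.
Proof.
have [h hE] := falg_univ (fun z : option X => if z is Some a then f (fgen C a) else b).
exists h; last first.
  move=> h' h'S h'N; apply: falg_ext => -[a|]; rewrite hE //.
  by rewrite -h'S fmap_letters_gen.
split; last by rewrite hE.
by apply: (falg_ext (g := h \o fmap_letters Some)) => a /=; rewrite fmap_letters_gen hE.
Qed.

Lemma free_power_univ (f : I -> {lrmorphism F X -> B}) :
  exists2 h : {lrmorphism F (I * X)%type -> B},
    (forall i x, h (fmap_letters (pair i) x) = f i x) &
    forall h' : {lrmorphism F (I * X)%type -> B},
      (forall i x, h' (fmap_letters (pair i) x) = f i x) -> h' =1 h.
Proof.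
have [h hE] := falg_univ (fun z : I * X => f z.1 (fgen C z.2)).
exists h; last first.
  move=> h' h'E; apply: falg_ext => -[i a]; rewrite hE.
  by rewrite -h'E fmap_letters_gen.
move=> i; apply: (falg_ext (g := h \o fmap_letters (pair i))) => a /=.
by rewrite fmap_letters_gen hE.
Qed.

End FreeProductsUniv.

Section StarStructures.
Variable C : numClosedFieldType.

Record star_algebra (A : lalgType C) (st : A -> A) : Prop := StarAlgebra {
  star_antilinear : forall c x y, st (c *: x + y) = c^* *: st x + st y;
  star_antimult : forall x y, st (x * y) = st y * st x;
  star_invol : involutive st }.

Definition star_preserving (A B : Type) (sA : A -> A) (sB : B -> B) (f : A -> B) :=
  forall x, f (sA x) = sB (f x).

Variable K : monomType.
Local Notation A := {malg C[K]}.
Local Notation A2 := {malg C[(K * K)%type]}.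

Record coalgebra (D : A -> A2) (e : A -> C) : Prop := Coalgebra {
  coassoc : forall x, tassoc (tmap D id (D x)) = tmap id D (D x);
  counit_l : forall x, tlift (fun y z => e y *: z) (D x) = x;
  counit_r : forall x, tlift (fun y z => e z *: y) (D x) = x }.

Record star_bialgebra (s : K -> K) (D : {lrmorphism A -> A2})
    (e : {lrmorphism A -> C | *%R}) : Prop := StarBialgebra {
  sb_star : star_algebra (malg_star s : A -> A);
  sb_coalgebra : coalgebra D e;
  sb_comul_star : star_preserving (malg_star s) (malg_star (pair_star s s)) D;
  sb_counit_star : star_preserving (malg_star s) Num.conj e }.

End StarStructures.

Lemma word_starM (X : choiceType) (i : X -> X) (u v : {fmonom X}) :
  word_star i (mmul u v) = mmul (word_star i v) (word_star i u).
Proof. by apply/eqP; rewrite fmP fmM /= fmM map_cat rev_cat. Qed.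

Lemma word_starK (X : choiceType) (i : X -> X) :
  involutive i -> involutive (word_star i).
Proof.
by move=> iK u; apply/eqP; rewrite fmP /= map_rev revK mapK.
Qed.

Lemma fgen_star (C : numClosedFieldType) (X : choiceType) (i : X -> X) (a : X) :
  malg_star (word_star i) (fgen C a) = fgen C (i a).
Proof.
by rewrite /fgen malg_starU; congr << _ >>; apply/eqP; rewrite fmP /= !fmU.
Qed.

Lemma falg_lift_star (C : numClosedFieldType) (X : choiceType) (i : X -> X)
    (K : monomType) (s : K -> K) (f : X -> {malg C[K]}) :
  (forall u v, s (mmul u v) = mmul (s v) (s u)) -> s (@mone K) = @mone K ->
  (forall a, f (i a) = malg_star s (f a)) ->
  star_preserving (malg_star (word_star i)) (malg_star s) (falg_lift f).
Proof.
move=> sM s1 fs; elim/malg_basis_ind => [|c w x IH].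
  by rewrite malg_star0 linear0 malg_star0.
rewrite malg_star_antilinear !linearP /= malg_star_antilinear IH malg_starU.
congr (_ *: _ + _); rewrite /falg_lift !mlinU /=.
case: w => w /=; elim: w => [|a w IHw].
  by rewrite !big_nil malg_starU s1.
by rewrite rev_cons -cats1 big_cat big_seq1 /= IHw big_cons malg_starM // fs.
Qed.

(* The letters a and a^* of G = G^+ u G^- are (a, false) and (a, true). *)
Section Letters.
Variable Gp : choiceType.

Definition letter : choiceType := (Gp * bool)%type.

Definition letter_star (a : letter) : letter := (a.1, ~~ a.2).

(* Some a is the letter a, and None is t. *)
Definition tletter_star : option letter -> option letter := omap letter_star.

Definition sum_star (a : letter + letter) : letter + letter :=
  match a with inl b => inl (letter_star b) | inr b => inr (letter_star b) end.

(* The index i : 'I_m stands for the factor number i + 1. *)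
Definition copies_star (m : nat) (p : 'I_m * option letter) :
  'I_m * option letter := (p.1, tletter_star p.2).

End Letters.

Definition words (X : choiceType) : monomType := {fmonom X}.
Definition twords (m : nat) (Gp : choiceType) : monomType :=
  words ('I_m * option (letter Gp))%type.
Definition twords2 (m : nat) (Gp : choiceType) : monomType :=
  (twords m Gp * twords m Gp)%type.

Notation alg C Gp := {malg C[words (letter Gp)]}.
Notation alg_free2 C Gp := {malg C[words (letter Gp + letter Gp)%type]}.
Notation alg_tilde C m Gp := {malg C[twords m Gp]}.
Notation alg_tilde2 C m Gp := {malg C[twords2 m Gp]}.

Section Maps.
Variables (C : numClosedFieldType) (m : nat) (Gp : choiceType).
Local Notation At := (alg_tilde C m Gp).
Local Notation At2 := (alg_tilde2 C m Gp).

Definition tilde_star : At -> At := malg_star (word_star (@copies_star Gp m)).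
Definition tilde2_star : At2 -> At2 :=
  malg_star (pair_star (word_star (@copies_star Gp m))
                       (word_star (@copies_star Gp m))).

(* [acopy a k] is a_(k+1) for k < m, and a_(m+1) = 0 for k = m. *)
Definition acopy (a : letter Gp) (k : nat) : At :=
  if insub k is Some i then fgen C (i, Some a) else 0.

Definition adiff (a : letter Gp) (k : 'I_m) : At := acopy a k - acopy a k.+1.

Definition tcopy (k : 'I_m) : At := fgen C (k, None).

(* t_[k,m], with the factors in increasing order *)
Definition ttail (k : 'I_m) : At := \prod_(i < m | (k <= i)%N) tcopy i.

(* t_[k,m] on G^+, and its adjoint t_(m) ... t_(k) on G^- *)
Definition ttail_adj (a : letter Gp) (k : 'I_m) : At :=
  if a.2 then tilde_star (ttail k) else ttail k.

Definition ihat1 : alg C Gp -> At := falg_lift (acopy^~ 0).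

Definition delta : alg C Gp -> alg_free2 C Gp :=
  falg_lift (fun a => fgen C (inl a) + fgen C (inr a)).

(* j^(m), with T a k in the place of t_[k,m] in the image of the letter a;
   see [comul_formulas] for the two choices of T. *)
Definition jhat_with (T : letter Gp -> 'I_m -> At) : alg_free2 C Gp -> At2 :=
  falg_lift (fun b => match b with
    | inl a => \sum_(k < m) adiff a k \ox T a k
    | inr a => \sum_(k < m) T a k \ox adiff a k
    end).

End Maps.

Section Checks.
Variables (C : numClosedFieldType) (m : nat) (Gp : choiceType).
Local Notation At := (alg_tilde C m Gp).
Local Notation tstar := (@tilde_star C m Gp).

Lemma copies_starK : involutive (@copies_star Gp m).
Proof. by move=> [i [[a b]|]] //; rewrite /copies_star /= /letter_star /= negbK. Qed.

Lemma tilde_star_algebra : star_algebra tstar.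
Proof.
split; first exact: malg_star_antilinear.
  exact/malg_starM/word_starM.
exact/malg_starK/word_starK/copies_starK.
Qed.

Lemma acopy_star (a : letter Gp) k :
  acopy C m (letter_star a) k = tstar (acopy C m a k).
Proof.
rewrite /acopy; case: insubP => [i _ _|_].
  by rewrite /tilde_star fgen_star.
by rewrite /tilde_star malg_star0.
Qed.

Lemma adiff_star (a : letter Gp) (k : 'I_m) :
  adiff C (letter_star a) k = tstar (adiff C a k).
Proof.
rewrite /adiff !acopy_star; set x := acopy C m a k; set y := acopy C m a k.+1.
have -> : x - y = -1 *: y + x by rewrite scaleN1r addrC.
by rewrite /tilde_star malg_star_antilinear rmorphN1 scaleN1r addrC.
Qed.

Lemma ttail_adj_star (a : letter Gp) (k : 'I_m) :
  ttail_adj C (letter_star a) k = tstar (ttail_adj C a k).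
Proof.
rewrite /ttail_adj /=; case: a.2 => //=.
by rewrite (star_invol tilde_star_algebra).
Qed.

Lemma jhat_adj_star : star_preserving
  (malg_star (word_star (@sum_star Gp))) (@tilde2_star C m Gp)
  (jhat_with (@ttail_adj C m Gp)).
Proof.
apply: falg_lift_star => [u v||[a|a]] /=.
- by rewrite /pair_star /= !word_starM.
- by congr (_, _); apply/eqP; rewrite fmP /= fm1.
- rewrite malg_star_sum; apply: eq_bigr => k _.
  by rewrite malg_star_tens adiff_star ttail_adj_star.
- rewrite malg_star_sum; apply: eq_bigr => k _.
  by rewrite malg_star_tens adiff_star ttail_adj_star.
Qed.

End Checks.

(* For m >= 2 the involution reverses t_[k,m], so that no map preserving the
   involution can satisfy the formula for the coproduct of a_(k) - a_(k+1) with
   t_[k,m] on both G^+ and G^- as soon as k < m. *)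
Section Obstruction.
Variables (C : numClosedFieldType) (m : nat) (Gp : choiceType).
Local Notation At := (alg_tilde C m Gp).
Local Notation tstar := (@tilde_star C m Gp).

Definition tword (k : 'I_m) : twords m Gp :=
  FMonom [seq (i, None) | i : 'I_m <- index_enum 'I_m & (k <= i)%N].

Lemma ttailE (k : 'I_m) : ttail C Gp k = << tword k >>.
Proof.
rewrite /ttail -big_filter /tword; elim: (filter _ _) => [|i r IH].
  by rewrite big_nil; congr << _ >>; apply/eqP; rewrite fmP fm1.
rewrite big_cons IH /tcopy /fgen malgUM; congr << _ >>; apply/eqP.
by rewrite fmP fmM fmU.
Qed.

Lemma tword_rev (k : 'I_m) : (k.+1 < m)%N ->
  word_star (@copies_star Gp m) (tword k) != tword k.
Proof.
move=> km; apply/negP; rewrite fmP /= => /eqP /(congr1 (map (fun p => val p.1))).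
rewrite map_rev -!map_comp => revE.
have {revE} : rev [seq val i | i : 'I_m <- index_enum 'I_m & (k <= i)%N] =
              [seq val i | i : 'I_m <- index_enum 'I_m & (k <= i)%N] by exact: revE.
have -> : [seq val i | i : 'I_m <- index_enum 'I_m & (k <= i)%N] = iota k (m - k).
  have -> : [seq i : 'I_m <- index_enum 'I_m | (k <= i)%N] =
            [seq i <- index_enum 'I_m | preim val (leq k) i] by [].
  rewrite -filter_map [index_enum _]unlock -enumT val_enum_ord.
  apply: (irr_sorted_eq ltn_trans ltnn).
  - exact/sorted_filter/iota_ltn_sorted/ltn_trans.
  - exact: iota_ltn_sorted.
  by move=> i; rewrite mem_filter !mem_iota subnKC // ltnW.
move=> /(congr1 (nth 0 ^~ 0)).
have mk : (1 < m - k)%N by rewrite ltn_subRL addn1.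
have mk0 : (0 < m - k)%N by rewrite ltnW.
rewrite nth_rev ?size_iota // !nth_iota ?subn_gt0 ?ltn_subrL ?mk0 //.
move=> /eqP; rewrite eqn_add2l subn_eq0 leqNgt.
by rewrite mk.
Qed.

Lemma comul_not_star (g : Gp) (k : 'I_m) (D : At -> alg_tilde2 C m Gp) :
  (k.+1 < m)%N ->
  (forall a : letter Gp, a.1 = g -> D (adiff C a k) =
     adiff C a k \ox ttail C Gp k + ttail C Gp k \ox adiff C a k) ->
  ~ star_preserving tstar (@tilde2_star C m Gp) D.
Proof.
move=> km DE Dst; pose a : letter Gp := (g, false); pose a' : letter Gp := (g, true).
have key (d d' T : At) : tstar d = d' -> D d = d \ox T + T \ox d ->
    D d' = d' \ox T + T \ox d' ->
    forall u v, d'@_u * T@_v + T@_u * d'@_v =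
                d'@_u * (tstar T)@_v + (tstar T)@_u * d'@_v.
  move=> dE Dd Dd' u v.
  have E : d' \ox T + T \ox d' = d' \ox tstar T + tstar T \ox d'.
    transitivity (D d'); first exact: esym Dd'.
    rewrite -dE Dst Dd /tilde2_star malg_starD.
    by congr (_ + _); exact: malg_star_tens.
  have c (x y x' y' : At) :
      (x \ox y + x' \ox y')@_(u, v) = x@_u * y@_v + x'@_u * y'@_v.
    by rewrite mcoeffD (mcoeff_tens x) (mcoeff_tens x').
  exact: etrans (esym (c _ _ _ _)) (etrans (congr1 (mcoeff (u, v)) E) (c _ _ _ _)).
have {key} := key _ _ _ (esym (adiff_star C a k)) (DE a erefl) (DE a' erefl).
pose w : twords m Gp := fmu (k, Some a').
move=> /(_ w (tword k)); rewrite (ttailE k) /tilde_star malg_starU.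
have tw : (tword k == w) = false.
  apply/negP; rewrite fmP fmU => /eqP; rewrite /tword /=.
  by case: (filter _ _) => // i r [].
have tw' : (word_star (@copies_star Gp m) (tword k) == w) = false.
  apply/negP; rewrite fmP fmU /= => /eqP /(congr1 rev); rewrite revK /=.
  by case: (filter _ _) => // i r [].
have -> : (adiff C (letter_star a) k)@_w = 1.
  have acopyE (i : 'I_m) : (acopy C m (letter_star a) i)@_w = (i == k)%:R.
    rewrite /acopy valK /fgen mcoeffU; congr (_%:R).
    by rewrite fmP !fmU eqseq_cons andbT xpair_eqE eqxx andbT.
  rewrite /adiff mcoeffB acopyE eqxx (acopyE (Ordinal km)).
  by rewrite -val_eqE /= gtn_eqF // subr0.
rewrite !mcoeffU tw tw' eqxx (negbTE (tword_rev km)) !mul0r !addr0 mulr0 mulr1.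
by move/eqP; rewrite oner_eq0.
Qed.

End Obstruction.

(* The formulas defining the coproduct and the counit, with T a k in the place
   of t_[k,m] for the letter a.  [fun=> ttail] gives the same t_[k,m] on G^+ and
   on G^-; by [comul_not_star] the coproduct then preserves the involution only
   for m = 1, and [ttail_adj] gives the *-homomorphism which satisfies the
   formulas for the *-generators a in G^+ and t_(i). *)
Section Formulas.
Variables (C : numClosedFieldType) (m : nat) (Gp : choiceType).
Local Notation At := (alg_tilde C m Gp).
Local Notation At2 := (alg_tilde2 C m Gp).

Record comul_formulas (T : letter Gp -> 'I_m -> At) (D : At -> At2) : Prop :=
  ComulFormulas {
    comul_one : D 1 = 1 \ox 1;
    comul_t : forall i, D (tcopy C Gp i) = tcopy C Gp i \ox tcopy C Gp i;
    comul_adiff : forall (a : letter Gp) (k : 'I_m),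
      D (adiff C a k) = adiff C a k \ox T a k + T a k \ox adiff C a k }.

Record counit_formulas (e : At -> C) : Prop := CounitFormulas {
  counit_one : e 1 = 1;
  counit_t : forall k, e (tcopy C Gp k) = 1;
  counit_a : forall (a : letter Gp) (k : 'I_m), e (acopy C m a k) = 0 }.

End Formulas.

(* Main.v *)
Require Import Defs.
From HB Require Import structures.
From mathcomp Require Import all_boot all_order all_algebra finmap.
From mathcomp Require Import reals complex.
From mathcomp.multinomials Require Import monalg.

Set Implicit Arguments.
Unset Strict Implicit.
Unset Printing Implicit Defensive.

Import GRing.Theory Num.Theory.
Local Open Scope ring_scope.

(** The letters t_(i) and the differences a_(k) - a_(k+1) generate the algebra:
    since a_(m+1) = 0, the sum of a_(k) - a_(k+1) over k >= i telescopes to a_(i)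
    ([acopy_sum_adiff]).  The prescribed coproduct of the differences thus
    determines that of the letters a_(i), and as the algebra is free on the
    letters a_(i) and t_(i), these values extend to a unique homomorphism
    ([comul]); telescoping backwards, it satisfies the formulas
    ([comul_adiff_twist]).

    In place of t_[k,m] any product T of letters t_(i) may stand, in any order
    and depending on the letter a.  The coproduct being multiplicative, T is
    group-like ([comul_tmonomial]), and a difference d is twisted primitive over
    it: d |-> d (x) T + T (x) d.  Both sides of coassociativity, and of the two
    counit laws, are homomorphisms, so they need only be compared on generators
    ([tilde_ext]).  On t_(i) they hold because t_(i) is group-like; on d, both
    iterated coproducts equal
    d (x) T (x) T + T (x) d (x) T + T (x) T (x) d, and the counit maps T to 1 and
    d to 0.

    The involution sends d to the difference for the letter a^*, so the coproduct
    preserves it as soon as T for a^* is the adjoint of T for a.  This is so by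
    construction when T is t_[k,m] on G^+ and its adjoint on G^-, and when T is
    t_[k,m] throughout it is so for m = 1, where t_[1,1] = t_(1) is self-adjoint.

    Finally a_(1) is the sum of all the differences, so its coproduct is the sum
    of the two images of a under j^(m), that is, j^(m) of delta a
    ([jhat_delta]). *)

(** * Homomorphisms on tensor products *)

Section TensorMorphisms.
Variable C : numClosedFieldType.

Lemma malg_monoid_morphism (K L : monomType)
    (F : {linear {malg C[K]} -> {malg C[L]}}) :
  F 1 = 1 -> (forall u v, F (<< u >> * << v >>) = F << u >> * F << v >>) ->
  monoid_morphism F.
Proof.
move=> F1 FM; split=> // x y.
elim/malg_basis_ind: x => [|c u x IH]; first by rewrite mul0r linear0 mul0r.
rewrite mulrDl -scalerAl !linearP IH mulrDl -scalerAl; congr (_ *: _ + _).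
elim/malg_basis_ind: y {IH} => [|d v y IH]; first by rewrite mulr0 linear0 mulr0.
by rewrite mulrDr -malg_scaleAr !linearP IH mulrDr -malg_scaleAr FM.
Qed.

Lemma tliftU (K L : choiceType) (V : lmodType C)
    (b : {malg C[K]} -> {malg C[L]} -> V) u v :
  tlift b << (u, v) >> = b << u >> << v >>.
Proof. by rewrite /tlift mlinU. Qed.

Lemma tensDl (K L : choiceType) (x x' : {malg C[K]}) (y : {malg C[L]}) :
  (x + x') \ox y = x \ox y + x' \ox y.
Proof. by have := tens_linear_l y 1 x x'; rewrite !scale1r. Qed.

Lemma tensDr (K L : choiceType) (x : {malg C[K]}) (y y' : {malg C[L]}) :
  x \ox (y + y') = x \ox y + x \ox y'.
Proof. exact: linearD. Qed.

HB.instance Definition _ (K L K' L' : choiceType) (f : {malg C[K]} -> {malg C[K']})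
  (g : {malg C[L]} -> {malg C[L']}) := GRing.Linear.on (tmap f g).
HB.instance Definition _ (K L M : choiceType) := GRing.Linear.on (@tassoc C K L M).

Lemma tmapE (K L K' L' : choiceType) (f : {linear {malg C[K]} -> {malg C[K']}})
    (g : {linear {malg C[L]} -> {malg C[L']}}) x y :
  tmap f g (x \ox y) = f x \ox g y.
Proof.
apply: tliftE => [z c a b|z c a b]; first by rewrite linearP tens_linear_l.
by rewrite !linearP.
Qed.

Lemma tassocE (K L M : choiceType) (x : {malg C[K]}) (y : {malg C[L]})
    (z : {malg C[M]}) : tassoc ((x \ox y) \ox z) = x \ox (y \ox z).
Proof.
rewrite /tassoc tliftE.
- apply: tliftE => [b c a a'|a c b b']; first by rewrite tens_linear_l.
  by rewrite tens_linear_l linearP.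
- by move=> w c a b; rewrite linearP.
move=> w c a b; apply: (malg_lin_ext (f := tlift _)
  (g := c \*: tlift _ \+ tlift _)) => -[u v] /=.
by rewrite !tliftU !linearP.
Qed.

(** The instances below make both sides of each coalgebra law homomorphisms, so
    that the law can be checked on generators. *)
Fact tmap_monoid (K L K' L' : monomType) (f : {lrmorphism {malg C[K]} -> {malg C[K']}})
  (g : {lrmorphism {malg C[L]} -> {malg C[L']}}) : monoid_morphism (tmap f g).
Proof.
apply: malg_monoid_morphism => [|[u v] [u' v']] /=.
  by rewrite -[X in tmap _ _ X]tens1 tmapE !rmorph1 tens1.
by rewrite -!tensUU tensM !tmapE !rmorphM tensM.
Qed.

HB.instance Definition _ (K L K' L' : monomType)
    (f : {lrmorphism {malg C[K]} -> {malg C[K']}})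
    (g : {lrmorphism {malg C[L]} -> {malg C[L']}}) :=
  GRing.isMonoidMorphism.Build _ _ (tmap f g) (tmap_monoid f g).

Fact tassoc_monoid (K L M : monomType) : monoid_morphism (@tassoc C K L M).
Proof.
apply: malg_monoid_morphism => [|[[u v] w] [[u' v'] w']] /=.
  by rewrite -[X in tassoc X]tens1 -tens1 tassocE !tens1.
by rewrite -!tensUU !tensM !tassocE !tensM.
Qed.

HB.instance Definition _ (K L M : monomType) :=
  GRing.isMonoidMorphism.Build _ _ (@tassoc C K L M) (@tassoc_monoid K L M).

(** The slice maps e (x) id and id (x) e, the scalar factor of their values being
    absorbed into the other factor. *)
Definition slice_l (K L : monomType) (e : {malg C[K]} -> C) :=
  tlift (fun (y : {malg C[K]}) (z : {malg C[L]}) => e y *: z).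
Definition slice_r (K L : monomType) (e : {malg C[L]} -> C) :=
  tlift (fun (y : {malg C[K]}) (z : {malg C[L]}) => e z *: y).

HB.instance Definition _ (K L : monomType) e := GRing.Linear.on (@slice_l K L e).
HB.instance Definition _ (K L : monomType) e := GRing.Linear.on (@slice_r K L e).

Lemma slice_lE (K L : monomType) (e : {scalar {malg C[K]}}) (x : {malg C[K]}) (y : {malg C[L]}) :
  slice_l e (x \ox y) = e x *: y.
Proof.
apply: tliftE => [z c a b|z c a b]; first by rewrite linearP scalerDl scalerA.
by rewrite scalerDr !scalerA mulrC.
Qed.

Lemma slice_rE (K L : monomType) (e : {scalar {malg C[L]}}) (x : {malg C[K]}) (y : {malg C[L]}) :
  slice_r e (x \ox y) = e y *: x.
Proof.
apply: tliftE => [z c a b|z c a b]; last by rewrite linearP scalerDl scalerA.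
by rewrite scalerDr !scalerA mulrC.
Qed.

Fact slice_l_monoid (K L : monomType) (e : {lrmorphism {malg C[K]} -> C | *%R}) :
  monoid_morphism (@slice_l K L e).
Proof.
apply: malg_monoid_morphism => [|[u v] [u' v']] /=.
  by rewrite -[X in slice_l _ X]tens1 slice_lE rmorph1 scale1r.
by rewrite -!tensUU tensM !slice_lE rmorphM -scalerA -scalerAl malg_scaleAr.
Qed.

Fact slice_r_monoid (K L : monomType) (e : {lrmorphism {malg C[L]} -> C | *%R}) :
  monoid_morphism (@slice_r K L e).
Proof.
apply: malg_monoid_morphism => [|[u v] [u' v']] /=.
  by rewrite -[X in slice_r _ X]tens1 slice_rE rmorph1 scale1r.
by rewrite -!tensUU tensM !slice_rE rmorphM -scalerA -scalerAl malg_scaleAr.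
Qed.

HB.instance Definition _ (K L : monomType) (e : {lrmorphism {malg C[K]} -> C | *%R}) :=
  GRing.isMonoidMorphism.Build _ _ (@slice_l K L e) (@slice_l_monoid K L e).
HB.instance Definition _ (K L : monomType) (e : {lrmorphism {malg C[L]} -> C | *%R}) :=
  GRing.isMonoidMorphism.Build _ _ (@slice_r K L e) (@slice_r_monoid K L e).

End TensorMorphisms.

(** * The generators of the free power *)

Section Bialgebra.
Variables (C : numClosedFieldType) (m : nat) (Gp : choiceType).
Local Notation At := (alg_tilde C m Gp).
Local Notation At2 := (alg_tilde2 C m Gp).
Local Notation tstar := (@tilde_star C m Gp).

Lemma acopy_ord (a : letter Gp) (i : 'I_m) : acopy C m a i = fgen C (i, Some a).
Proof. by rewrite /acopy valK. Qed.

Lemma acopy_out (a : letter Gp) : acopy C m a m = 0.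
Proof. by rewrite /acopy insubF ?ltnn. Qed.

Lemma acopy_sum_adiff (a : letter Gp) (j : nat) : (j <= m)%N ->
  acopy C m a j = \sum_(k < m | (j <= k)%N) adiff C a k.
Proof.
move=> jm; pose u k := acopy C m a k - acopy C m a k.+1.
rewrite -(big_geq_mkord j m predT u).
rewrite (telescope_sumr_eq (fun k => - acopy C m a k)) //; last first.
  by move=> k _; rewrite /u opprK addrC.
by rewrite acopy_out oppr0 opprK add0r.
Qed.

(** The differences generate the same algebra as the letters a_(i), by
    [acopy_sum_adiff]. *)
Lemma tilde_ext (B : lalgType C) (g h : {lrmorphism At -> B}) :
  (forall i, g (tcopy C Gp i) = h (tcopy C Gp i)) ->
  (forall a k, g (adiff C a k) = h (adiff C a k)) -> g =1 h.
Proof.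
move=> gh_t gh_a; apply: falg_ext => -[i [a|]]; last exact: gh_t.
rewrite -acopy_ord acopy_sum_adiff; last exact: ltnW.
by rewrite !linear_sum; apply: eq_bigr => k _; apply: gh_a.
Qed.

(** * The coproduct and the counit *)

Definition twist (x T : At) : At2 := x \ox T + T \ox x.

Section Comultiplication.
Variable T : letter Gp -> 'I_m -> At.

(** The value on a_(i) is forced by [acopy_sum_adiff] and the prescribed values
    on the differences. *)
Definition comul : At -> At2 := falg_lift (fun p : 'I_m * option (letter Gp) =>
  if p.2 is Some a then \sum_(k < m | (p.1 <= k)%N) twist (adiff C a k) (T a k)
  else tcopy C Gp p.1 \ox tcopy C Gp p.1).

HB.instance Definition _ := GRing.LRMorphism.on comul.

Lemma comul_tcopy i : comul (tcopy C Gp i) = tcopy C Gp i \ox tcopy C Gp i.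
Proof. exact: falg_lift_gen. Qed.

(** The case j = m, where both sides vanish, lets [comul_adiff_twist] treat the
    last difference a_(m) - a_(m+1) = a_(m) like the others. *)
Lemma comul_acopy (a : letter Gp) (j : nat) : (j <= m)%N ->
  comul (acopy C m a j) = \sum_(k < m | (j <= k)%N) twist (adiff C a k) (T a k).
Proof.
rewrite leq_eqVlt => /predU1P[->|jm].
  by rewrite acopy_out linear0 big_pred0 // => k; rewrite leqNgt ltn_ord.
by rewrite (acopy_ord a (Ordinal jm)) /comul falg_lift_gen.
Qed.

Lemma comul_adiff_twist a k : comul (adiff C a k) = twist (adiff C a k) (T a k).
Proof.
rewrite {1}/adiff linearB /= !comul_acopy //; last exact: ltnW.
rewrite (bigD1 k) //= (eq_bigl (fun i : 'I_m => (k < i)%N)) ?addrK // => i.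
by rewrite ltn_neqAle andbC eq_sym.
Qed.

Lemma comul_formulasP : comul_formulas T comul.
Proof.
split; first by rewrite rmorph1 tens1.
  exact: comul_tcopy.
exact: comul_adiff_twist.
Qed.

Lemma jhat_delta :
  jhat_with T \o @delta C Gp =1 comul \o @ihat1 C m Gp.
Proof.
apply: (falg_ext (g := jhat_with T \o @delta C Gp) (h := comul \o @ihat1 C m Gp)).
move=> a /=; rewrite /delta /ihat1 !falg_lift_gen comul_acopy //.
by rewrite linearD /= /jhat_with !falg_lift_gen -big_split.
Qed.

End Comultiplication.

HB.instance Definition _ T := GRing.LRMorphism.on (comul T).

Definition counit_gen (p : 'I_m * option (letter Gp)) : C :=
  if p.2 is Some a then 0 else 1.
Definition counit : At -> C := falg_lift (counit_gen : _ -> C^o).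

Fact counit_linear : scalar counit.
Proof. exact: (linearP (falg_lift (counit_gen : _ -> C^o))). Qed.
Fact counit_monoid : monoid_morphism counit.
Proof.
have scA c (x y : C^o) : c *: (x * y) = x * (c *: y) by apply: mulrCA.
exact: (falg_lift_monoid (counit_gen : _ -> C^o) scA).
Qed.
HB.instance Definition _ := GRing.isLinear.Build C At C *%R counit counit_linear.
HB.instance Definition _ := GRing.isMonoidMorphism.Build At C counit counit_monoid.

Lemma counit_tcopy k : counit (tcopy C Gp k) = 1.
Proof. exact: (falg_lift_gen (counit_gen : _ -> C^o)). Qed.

Lemma counit_acopy (a : letter Gp) (k : nat) : counit (acopy C m a k) = 0.
Proof.
rewrite /acopy; case: insubP => [i _ _|_]; last exact: linear0.
exact: (falg_lift_gen (counit_gen : _ -> C^o)).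
Qed.

Lemma counit_formulasP : counit_formulas counit.
Proof.
split=> [|k|a k]; [exact: rmorph1 | exact: counit_tcopy | exact: counit_acopy].
Qed.

Lemma counit_adiff (a : letter Gp) k : counit (adiff C a k) = 0.
Proof. by rewrite linearB /= !counit_acopy subrr. Qed.

(** The scalars commute, so reversing a word does not change the product of the
    values of its letters; these values are 0 or 1, hence real. *)
Lemma counit_star : star_preserving tstar Num.conj counit.
Proof.
elim/malg_basis_ind => [|c w x IH].
  by rewrite /tilde_star malg_star0 linear0 rmorph0.
rewrite /tilde_star malg_star_antilinear !linearP /= rmorphD rmorphM IH malg_starU.
congr (_ * _ + _); rewrite /counit /falg_lift !mlinU /=.
rewrite rmorph_prod (perm_big _ (permEl (perm_rev _))) big_map.
by apply: eq_bigr => -[i [a|]] _; rewrite /counit_gen /= ?rmorph0 ?rmorph1.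
Qed.

(** * Products of the letters t_(i) *)

Definition tmonomial (x : At) := exists s, x = \prod_(i <- s) tcopy C Gp i.

Lemma ttail_tmonomial k : tmonomial (ttail C Gp k).
Proof. by exists [seq i : 'I_m <- index_enum 'I_m | (k <= i)%N]; rewrite big_filter. Qed.

Lemma tstar_tmonomial x : tmonomial x -> tmonomial (tstar x).
Proof.
case=> s ->; exists (rev s); elim: s => [|i s IH].
  by rewrite !big_nil -[1 in LHS]/<< _ >> /tilde_star malg_starU; congr << _ >>;
    apply/eqP; rewrite fmP /= fm1.
rewrite big_cons (star_antimult (tilde_star_algebra C m Gp)) IH rev_cons.
by rewrite -cats1 big_cat big_seq1 /= /tilde_star fgen_star.
Qed.

Lemma ttail_adj_tmonomial a k : tmonomial (ttail_adj C a k).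
Proof.
rewrite /ttail_adj; case: a.2; last exact: ttail_tmonomial.
exact/tstar_tmonomial/ttail_tmonomial.
Qed.

Lemma counit_tmonomial x : tmonomial x -> counit x = 1.
Proof.
case=> s ->; rewrite rmorph_prod big1 // => i _; exact: counit_t counit_formulasP i.
Qed.

Lemma comul_tmonomial T x : tmonomial x -> comul T x = x \ox x.
Proof.
case=> s ->; elim: s => [|i s IH]; first by rewrite big_nil rmorph1 tens1.
by rewrite big_cons rmorphM /= IH comul_tcopy tensM.
Qed.

(** * The bialgebra laws *)

Section Coalgebra.
Variables (T : letter Gp -> 'I_m -> At) (Tmon : forall a k, tmonomial (T a k)).
Local Notation D := (comul T).

Lemma comul_coassoc x : tassoc (tmap D id (D x)) = tmap id D (D x).
Proof.
apply: (tilde_ext (g := @tassoc C _ _ _ \o tmap D idfun \o D)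
  (h := tmap idfun D \o D)) => [i|a k] /=.
  by rewrite comul_tcopy !tmapE /= comul_tcopy tassocE.
(* Generalizing the difference and T keeps them opaque: the computation uses
   only that d is twisted primitive over the group-like t. *)
have DT := comul_tmonomial T (Tmon a k); have := comul_adiff_twist T a k.
move: (adiff C a k) (T a k) DT => d t Dt Dd.
rewrite Dd /twist !linearD /= !tmapE /= Dd Dt /twist.
by rewrite tensDl tensDr linearD /= !tassocE addrA.
Qed.

Lemma comul_counit_l x : tlift (fun y z => counit y *: z) (D x) = x.
Proof.
apply: (tilde_ext (g := @slice_l C _ _ counit \o D) (h := idfun)) => [i|a k] /=.
  by rewrite comul_tcopy slice_lE /= counit_tcopy scale1r.
rewrite comul_adiff_twist linearD /= !slice_lE /= counit_adiff.
by rewrite counit_tmonomial // scale0r scale1r add0r.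
Qed.

Lemma comul_counit_r x : tlift (fun y z => counit z *: y) (D x) = x.
Proof.
apply: (tilde_ext (g := @slice_r C _ _ counit \o D) (h := idfun)) => [i|a k] /=.
  by rewrite comul_tcopy slice_rE /= counit_tcopy scale1r.
rewrite comul_adiff_twist linearD /= !slice_rE /= counit_adiff.
by rewrite counit_tmonomial // scale0r scale1r addr0.
Qed.

Lemma comul_coalgebra : coalgebra D counit.
Proof.
split; [exact: comul_coassoc | exact: comul_counit_l | exact: comul_counit_r].
Qed.

Hypothesis Tstar : forall a k, T (letter_star a) k = tstar (T a k).

Lemma comul_star : star_preserving tstar (@tilde2_star C m Gp) D.
Proof.
apply: falg_lift_star => [u v||[i [a|]]] /=.
- by rewrite /pair_star /= !word_starM.
- by congr (_, _); apply/eqP; rewrite fmP /= fm1.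
- rewrite malg_star_sum; apply: eq_bigr => k _.
  by rewrite /twist malg_starD !malg_star_tens adiff_star Tstar.
- by rewrite malg_star_tens /tcopy fgen_star.
Qed.

Lemma comul_star_bialgebra :
  star_bialgebra (word_star (@copies_star Gp m)) D counit.
Proof.
split; [exact: tilde_star_algebra | exact: comul_coalgebra |
        exact: comul_star | exact: counit_star].
Qed.

End Coalgebra.

(** For m = 1 the product t_[k,m] has the single factor t_(1) = t_(1)^*. *)
Lemma ttail_star_ord1 (k : 'I_m) : m = 1%N -> tstar (ttail C Gp k) = ttail C Gp k.
Proof.
move=> m1; have -> : ttail C Gp k = tcopy C Gp k.
  rewrite /ttail (big_pred1 k) // => i /=.
  have lt1 (j : 'I_m) : (j < 1)%N by rewrite -[X in (_ < X)%N]m1.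
  by move: (lt1 i) (lt1 k); rewrite !ltnS !leqn0 -val_eqE /= => /eqP-> /eqP->.
by rewrite /tilde_star fgen_star.
Qed.

End Bialgebra.

(* Literal formulas on all of G first (there the coproduct is a *-homomorphism
   exactly when m = 1 or G^+ is empty); then the *-bialgebra generated by the
   formulas on G^+ and t_(i), in which t_[k,m] becomes its adjoint on G^-. *)
Theorem theorem5p1 (R : realType) (Gp : choiceType) (m : nat) (m_gt0 : (0 < m)%N) :
  (exists (D : {lrmorphism alg_tilde R[i] m Gp -> alg_tilde2 R[i] m Gp})
          (e : {lrmorphism alg_tilde R[i] m Gp -> R[i] | *%R}),
     [/\ comul_formulas (fun=> @ttail R[i] m Gp) D,
         counit_formulas e /\
           star_preserving (@tilde_star R[i] m Gp) Num.conj e,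
         coalgebra D e,
         m = 1%N -> star_bialgebra (word_star (@copies_star Gp m)) D e &
         jhat_with (fun=> @ttail R[i] m Gp) \o @delta R[i] Gp
           =1 D \o @ihat1 R[i] m Gp]) /\
  (exists (D : {lrmorphism alg_tilde R[i] m Gp -> alg_tilde2 R[i] m Gp})
          (e : {lrmorphism alg_tilde R[i] m Gp -> R[i] | *%R}),
     [/\ comul_formulas (@ttail_adj R[i] m Gp) D,
         counit_formulas e,
         star_bialgebra (word_star (@copies_star Gp m)) D e &
         jhat_with (@ttail_adj R[i] m Gp) \o @delta R[i] Gp
           =1 D \o @ihat1 R[i] m Gp]).
Proof.
split; [exists (comul (fun=> @ttail R[i] m Gp)) |
        exists (comul (@ttail_adj R[i] m Gp))];
  exists (@counit R[i] m Gp).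
  have Tmon (a : letter Gp) k := @ttail_tmonomial R[i] m Gp k.
  split.
  - exact: comul_formulasP.
  - by split; [exact: counit_formulasP | exact: counit_star].
  - exact: comul_coalgebra.
  - by move=> m1; apply: comul_star_bialgebra => // a k; rewrite ttail_star_ord1.
  - exact: jhat_delta.
split.
- exact: comul_formulasP.
- exact: counit_formulasP.
- apply: comul_star_bialgebra => a k; first exact: ttail_adj_tmonomial.
  exact: ttail_adj_star.
- exact: jhat_delta.
Qed.
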